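(* Let $X$ be an infinite-dimensional real normed space. Then there exists an approximately convex set $A\subseteq X$ such that $\mathcal{H}(A,\operatorname{Co}(A))=\infty$.
   Context: A set $A\subseteq X$ is approximately convex if $d(tx+(1-t)y,A)\le 1$ for all $x,y\in A$ and $t\in[0,1]$, where $d(x,A)=\inf_{a\in A}\|x-a\|$. $\mathcal{H}(A,B)=\sup\{d(x,B),d(y,A):x\in A,y\in B\}$ is the Hausdorff distance and $\operatorname{Co}(A)$ the convex hull. *)

(* Defs.v *)
From HB Require Import structures.
From mathcomp Require Import all_boot all_order all_algebra.
From mathcomp Require Import all_classical all_reals all_analysis.
Set Implicit Arguments. Unset Strict Implicit. Unset Printing Implicit Defensive.
Import Order.TTheory GRing.Theory Num.Theory.
Import numFieldNormedType.Exports.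
Local Open Scope classical_set_scope.
Local Open Scope ring_scope.

Definition finite_dimensional (R : realType) (X : normedModType R) : Prop :=
  exists (n : nat) (e : 'I_n -> X),
    forall x : X, exists c : 'I_n -> R, x = \sum_(i < n) c i *: e i.

Definition infinite_dimensional (R : realType) (X : normedModType R) : Prop :=
  ~ finite_dimensional X.

(* d(x, A) = inf_{a in A} ||x - a||, in the extended reals (+oo if A empty). *)
Definition dist_set (R : realType) (X : normedModType R) (x : X) (A : set X)
  : \bar R :=
  ereal_inf [set (`|x - a|)%:E | a in A].

Definition approx_convex (R : realType) (X : normedModType R) (A : set X) : Prop :=
  forall x y : X, A x -> A y -> forall t : R, 0 <= t <= 1 ->
    (dist_set (t *: x + (1 - t) *: y)%R A <= 1%:E)%E.

Definition hausdorff (R : realType) (X : normedModType R) (A B : set X) : \bar R :=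
  ereal_sup ([set dist_set x B | x in A] `|` [set dist_set y A | y in B]).

Definition conv_hull (R : realType) (X : normedModType R) (A : set X) : set X :=
  [set x | exists (n : nat) (a : 'I_n -> X) (l : 'I_n -> R),
      [/\ (forall i, A (a i)), (forall i, 0 <= l i), \sum_(i < n) l i = 1
        & x = \sum_(i < n) l i *: a i]].

(* Main.v *)
(** Shannon entropy (with natural logarithm) is convex up to an additive error
    [1] on the simplex of probability weights and vanishes at its vertices.  So
    the epigraph, in a unit direction [w], of the entropy of the barycentric
    coordinates on the simplex with vertices [e i] is approximately convex,
    whatever the vertices are.  Stretching the simplex leaves this unchanged
    and makes the entropy vary slowly: if [w] and the [e i] come from a
    biorthogonal system whose coordinate functionals decay, every point of the
    epigraph near the uniform average of the [N] vertices with indices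
    [N <= i < 2N] has entropy of order [ln N], hence is far away along [w].
    The coordinate functionals come from the one-vector Hahn-Banach theorem,
    obtained here from a minimal sublinear functional below the norm. *)
Require Import Defs.
From HB Require Import structures.
From mathcomp Require Import all_boot all_order all_algebra.
From mathcomp Require Import all_classical all_reals all_analysis.
From mathcomp Require Import ring lra.
Import Order.TTheory GRing.Theory Num.Theory.
Import numFieldNormedType.Exports.
Local Open Scope classical_set_scope.
Local Open Scope ring_scope.

(** * Sublinear functionals and the Hahn-Banach theorem *)

Definition sublinear {R : realType} {X : lmodType R} (q : X -> R) :=
  (forall x y, q (x + y) <= q x + q y) /\
  (forall t x, 0 < t -> q (t *: x) <= t * q x).

Definition linear_form {R : realType} {X : lmodType R} (g : X -> R) :=
  (forall x y, g (x + y) = g x + g y) /\ (forall t x, g (t *: x) = t * g x).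

Definition inf_fun {R : realType} {X : Type} (S : set (X -> R)) (x : X) : R :=
  inf [set q x | q in S].

Lemma inf_fun_le {R : realType} {X : Type} (S : set (X -> R)) (q : X -> R) x m :
  S q -> (forall q, S q -> m <= q x) -> inf_fun S x <= q x.
Proof.
by move=> Sq Sm; apply: ge_inf; [exists m => _ [r Sr <-]; exact: Sm|exists q].
Qed.

Lemma inf_fun_ge {R : realType} {X : Type} (S : set (X -> R)) x m :
  S !=set0 -> (forall q, S q -> m <= q x) -> m <= inf_fun S x.
Proof.
move=> [q Sq] Sm; apply: lb_le_inf; first by exists (q x), q.
by move=> _ [r Sr <-]; exact: Sm.
Qed.

(** Members of [S] need not be sublinear, and the dominating member may depend on the points. This
    covers the translates in [shift] as well as chains. *)
Lemma sublinear_inf_fun {R : realType} {X : lmodType R} (S : set (X -> R)) :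
  S !=set0 ->
  (forall x, exists m, forall q, S q -> m <= q x) ->
  (forall q1 q2 x y, S q1 -> S q2 ->
    exists2 q, S q & q (x + y) <= q1 x + q2 y) ->
  (forall q t x, S q -> 0 < t -> exists2 q', S q' & q' (t *: x) <= t * q x) ->
  sublinear (inf_fun S).
Proof.
move=> S0 Sm SD SZ; split=> [x y|t x t0].
  have [m mS] := Sm (x + y).
  rewrite -lerBlDr; apply: inf_fun_ge => // q1 Sq1.
  rewrite lerBlDr -lerBlDl; apply: inf_fun_ge => // q2 Sq2.
  have [q Sq le_q] := SD q1 q2 x y Sq1 Sq2.
  rewrite lerBlDl; apply: le_trans le_q; exact: inf_fun_le mS.
have [m mS] := Sm (t *: x).
rewrite -ler_pdivrMl//; apply: inf_fun_ge => // q Sq.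
have [q' Sq' le_q] := SZ q t x Sq t0.
rewrite ler_pdivrMl//; apply: le_trans le_q; exact: inf_fun_le mS.
Qed.

Lemma sublinearZ {R : realType} {X : lmodType R} (q : X -> R) t x :
  sublinear q -> 0 < t -> q (t *: x) = t * q x.
Proof.
move=> [_ qZ] t0; apply/eqP; rewrite eq_le qZ//=.
rewrite -ler_pdivlMl// -{1}[x](scalerK (lt0r_neq0 t0)) qZ//.
by rewrite invr_gt0.
Qed.

Lemma sublinear_geN {R : realType} {X : lmodType R} (q : X -> R) x :
  sublinear q -> - q (- x) <= q x.
Proof.
move=> [qD qZ]; have := qD 0 0; rewrite addr0 => q0.
have := qD x (- x); rewrite subrr; lra.
Qed.

(* The directional infimum that makes a minimal sublinear functional additive:
   it lies below [q], so it equals [q] when [q] is minimal. *)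
Definition shift {R : realType} {X : lmodType R} (q : X -> R) (y : X) : X -> R :=
  inf_fun [set (fun x => q (x + t *: y) - t * q y) | t in [set t | 0 < t]].

(** Subadditivity for [t *: y = - x + (x + t *: y)]. The bound is free of [t], so the infimum in
    [shift] is finite. *)
Lemma shift_lbound {R : realType} {X : lmodType R} (q : X -> R) t x y :
  sublinear q -> 0 < t -> - q (- x) <= q (x + t *: y) - t * q y.
Proof.
move=> sq t0; rewrite -sublinearZ//.
have [/(_ (- x) (x + t *: y)) + _] := sq.
rewrite addrA addNr add0r; lra.
Qed.

Lemma shift_le {R : realType} {X : lmodType R} (q : X -> R) t x y :
  sublinear q -> 0 < t -> shift q y x <= q (x + t *: y) - t * q y.
Proof.
move=> sq t0; rewrite /shift.
apply: (@inf_fun_le _ _ _ (fun x => q (x + t *: y) - t * q y) _ (- q (- x))).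
  by exists t.
by move=> _ [s /= s0 <-]; exact: shift_lbound.
Qed.

Lemma shift_le_id {R : realType} {X : lmodType R} (q : X -> R) x y :
  sublinear q -> shift q y x <= q x.
Proof.
move=> sq; apply: (le_trans (shift_le _ 1 _ _ sq _)) => //.
by have [/(_ x y) + _] := sq; rewrite scale1r mul1r; lra.
Qed.

Lemma sublinear_shift {R : realType} {X : lmodType R} (q : X -> R) y :
  sublinear q -> sublinear (shift q y).
Proof.
move=> sq; have [qD _] := sq; apply: sublinear_inf_fun.
- by eexists; exists 1 => //=.
- move=> x; exists (- q (- x)) => _ [t /= t0 <-]; exact: shift_lbound.
- move=> _ _ x z [t /= t0 <-] [s /= s0 <-].
  eexists; first by exists (t + s) => //=; rewrite addr_gt0.
  have := qD (x + t *: y) (z + s *: y).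
  rewrite scalerDl addrACA; lra.
- move=> _ s x [t /= t0 <-] s0.
  eexists; first by exists (s * t) => //=; rewrite mulr_gt0.
  by rewrite -scalerA -scalerDr sublinearZ// mulrBr mulrA.
Qed.

(** Zorn's lemma for the reversed pointwise order; a nonempty chain is bounded by its pointwise
    infimum, finite because [- p (- x)] bounds every member from below. *)
Lemma minimal_sublinear {R : realType} {X : lmodType R} (p : X -> R) :
  sublinear p -> exists q, [/\ sublinear q, forall x, q x <= p x &
    forall r, sublinear r -> (forall x, r x <= q x) -> forall x, q x <= r x].
Proof.
move=> sp; pose T := {q : X -> R | sublinear q /\ forall x, q x <= p x}.
pose D : rel T := fun q r => `[< forall x, sval r x <= sval q x >].
have p0 : T by exists p.
have [|||q qmin] := @ZL_preorder T p0 D.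
- by move=> q; apply/asboolP.
- move=> r s t /asboolP rs /asboolP st; apply/asboolP => x.
  exact: le_trans (st x) (rs x).
- move=> A Atot; have [A0|/set0P] := eqVneq A set0.
    by exists p0 => s; rewrite A0.
  move=> [q0 Aq0].
  pose S := [set sval q | q in A].
  have S0 : S !=set0 by exists (sval q0), q0.
  have Slb x : forall q, S q -> - p (- x) <= q x.
    move=> _ [[q [sq qp]] /= Aq <-].
    by apply: le_trans (sublinear_geN q x sq); rewrite lerN2.
  have sS : sublinear (inf_fun S).
    apply: sublinear_inf_fun => //.
    + by move=> x; exists (- p (- x)); exact: Slb.
    + move=> _ _ x y [q1 Aq1 <-] [q2 Aq2 <-].
      have [[[sD1 _] _] [[sD2 _] _]] := (svalP q1, svalP q2).
      have [/asboolP le21|/asboolP le12] := Atot _ _ Aq1 Aq2.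
        exists (sval q2); first by exists q2.
        by apply: (le_trans (sD2 _ _)); rewrite lerD2r.
      exists (sval q1); first by exists q1.
      by apply: (le_trans (sD1 _ _)); rewrite lerD2l.
    + move=> _ t x [q Aq <-] t0; exists (sval q); first by exists q.
      by have [[_ qZ] _] := svalP q; exact: qZ.
  have Sp x : inf_fun S x <= p x.
    have [_ /(_ x)] := svalP q0; apply: le_trans.
    by apply: inf_fun_le (Slb x); exists q0.
  exists (exist _ (inf_fun S) (conj sS Sp)) => s As; apply/asboolP => x /=.
  by apply: inf_fun_le (Slb x); exists s.
have [sq qp] := svalP q.
exists (sval q); split=> // r sr rq x.
have rp y : r y <= p y by exact: le_trans (rq y) (qp y).
have /asboolP/= := qmin (exist _ r (conj sr rp)) (introT (asboolP _) rq).
exact.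
Qed.

(** A minimal [q] lies below its own [shift]; the parameter 1 gives [q x <= q (x + y) - q y], hence
    additivity. *)
Lemma hahn_banach_sublinear {R : realType} {X : lmodType R} (p : X -> R) :
  sublinear p -> exists2 g, linear_form g & forall x, g x <= p x.
Proof.
move=> /minimal_sublinear[q [sq qp qmin]]; exists q => //.
have [qD qZ] := sq.
have qE x y : q (x + y) = q x + q y.
  apply/eqP; rewrite eq_le qD/= -lerBrDr.
  apply: (le_trans (qmin _ (sublinear_shift _ y sq) _ x)).
    by move=> z; exact: shift_le_id.
  by apply: (le_trans (shift_le _ 1 _ _ sq _)); rewrite // scale1r mul1r.
have q0 : q 0 = 0.
  by apply/eqP; have /eqP := qE 0 0; rewrite addr0 -subr_eq0 opprD addNKr oppr_eq0.
have qN x : q (- x) = - q x.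
  by apply/eqP; rewrite -addr_eq0 -qE addNr q0.
split=> // t x; have [t0|t0|->] := ltgtP t 0; last by rewrite scale0r mul0r.
  have := sublinearZ q (- t) x sq.
  by rewrite scaleNr qN mulNr oppr_gt0 => /(_ t0)/oppr_inj.
by rewrite sublinearZ.
Qed.

(** Domination by the shift of the norm along [v], rather than by the norm, forces the value at [v]:
    at [- v] the shift is at most [|- v + v| - |v|]. *)
Lemma norming_functional {R : realType} {X : normedModType R} (v : X) :
  exists g : X -> R, [/\ linear_form g, forall x, `|g x| <= `|x| & g v = `|v|].
Proof.
have sn : sublinear (fun x : X => `|x|).
  by split=> [x y|t x t0]; [exact: ler_normD|rewrite normrZ gtr0_norm].
have [g gl gs] := hahn_banach_sublinear _ (sublinear_shift _ v sn).
have [gD gZ] := gl.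
have gN x : g (- x) = - g x by rewrite -scaleN1r gZ mulN1r.
have gn x : g x <= `|x| := le_trans (gs x) (shift_le_id _ x v sn).
exists g; split=> //.
  by move=> x; rewrite ler_norml gn andbT lerNl -gN -normrN.
apply/eqP; rewrite eq_le gn/= -lerN2 -gN.
apply: (le_trans (gs _)); apply: (le_trans (shift_le _ 1 _ _ sn _)) => //.
by rewrite scale1r addNr normr0 mul1r sub0r.
Qed.

(** * Bounded forms and biorthogonal sequences *)

Definition bounded_form {R : realType} {X : normedModType R} (g : X -> R) :=
  linear_form g /\ exists C, forall x, `|g x| <= C * `|x|.

Lemma linear_form_sum {R : realType} {X : lmodType R} (g : X -> R) n
    (c : 'I_n -> R) (e : 'I_n -> X) :
  linear_form g -> g (\sum_(i < n) c i *: e i) = \sum_(i < n) c i * g (e i).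
Proof.
move=> [gD gZ]; elim/big_rec2: _ => [|i a b _ <-]; last by rewrite gD gZ.
by rewrite -(scale0r 0) gZ mul0r.
Qed.

Lemma linear_formB {R : realType} {X : lmodType R} (g : X -> R) x y :
  linear_form g -> g (x - y) = g x - g y.
Proof. by move=> [gD gZ]; rewrite gD -scaleN1r gZ mulN1r. Qed.

Lemma bounded_formB {R : realType} {X : normedModType R} (f g : X -> R) :
  bounded_form f -> bounded_form g -> bounded_form (fun x => f x - g x).
Proof.
move=> [[fD fZ] [C fC]] [[gD gZ] [D gD']]; split; first split.
- by move=> x y; rewrite fD gD opprD addrACA.
- by move=> t x; rewrite fZ gZ mulrBr.
exists (C + D) => x; rewrite mulrDl; apply: (le_trans (ler_normB _ _)).
exact: lerD.
Qed.

Lemma bounded_form_scale {R : realType} {X : normedModType R} (f : X -> R) a :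
  bounded_form f -> bounded_form (fun x => a * f x).
Proof.
move=> [[fD fZ] [C fC]]; split; first split.
- by move=> x y; rewrite fD mulrDr.
- by move=> t x; rewrite fZ mulrCA.
by exists (`|a| * C) => x; rewrite normrM -mulrA ler_wpM2l.
Qed.

Lemma bounded_form_sum {R : realType} {X : normedModType R} n
    (a : 'I_n -> R) (g : 'I_n -> X -> R) :
  (forall i, bounded_form (g i)) ->
  bounded_form (fun x => \sum_(i < n) a i * g i x).
Proof.
move=> bg; have [b bE] := choice (fun i => (bg i).2).
split; first split.
- move=> x y; rewrite -big_split; apply: eq_bigr => i _.
  by rewrite (bg i).1.1 mulrDr.
- move=> t x; rewrite mulr_sumr; apply: eq_bigr => i _.
  by rewrite (bg i).1.2 mulrCA.
exists (\sum_(i < n) `|a i| * b i) => x; rewrite mulr_suml.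
apply: (le_trans (ler_norm_sum _ _ _)); apply: ler_sum => i _.
by rewrite normrM -mulrA ler_wpM2l.
Qed.

Definition biorthogonal {R : realType} {X : normedModType R} n
    (u : nat -> X * (X -> R)) :=
  (forall i, (i < n)%N -> bounded_form (u i).2) /\
  (forall i j, (i < n)%N -> (j < n)%N -> (u i).2 (u j).1 = (i == j)%:R).

Lemma biorthogonal_extend {R : realType} {X : normedModType R} n
    (u : nat -> X * (X -> R)) :
  infinite_dimensional X -> biorthogonal n u ->
  exists p : X * (X -> R), [/\ bounded_form p.2, p.2 p.1 = 1,
    forall i, (i < n)%N -> (u i).2 p.1 = 0 &
    forall i, (i < n)%N -> p.2 (u i).1 = 0].
Proof.
move=> infX [ub uo].
have [v v0 uv] : exists2 v, v != 0 & forall i, (i < n)%N -> (u i).2 v = 0.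
  (* Were 0 the only common zero of the functionals, every [x] would equal its expansion in the
     [(u i).1], since the remainder is a common zero. *)
  apply: contrapT => nov; apply: infX; exists n, (fun i => (u i).1) => x.
  exists (fun i => (u i).2 x); apply/eqP; rewrite -subr_eq0.
  apply: contrapT => /negP xn; apply: nov; eexists; first exact: xn.
  move=> i ni; have [gl _] := ub i ni.
  rewrite linear_formB// linear_form_sum// (bigD1 (Ordinal ni))//= uo// eqxx mulr1.
  rewrite big1 ?addr0 ?subrr// => j ji.
  by rewrite uo// eq_sym -[i]/(nat_of_ord (Ordinal ni)) (inj_eq val_inj) (negbTE ji) mulr0.
have [h [hl hn hv]] := norming_functional v.
have hb : bounded_form h by split=> //; exists 1 => x; rewrite mul1r.
(* The sum makes the form vanish on the earlier vectors; it is zero at [v], so the value there is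
   still [|v|] before normalising. *)
pose g x := `|v|^-1 * (h x - \sum_(i < n) h (u i).1 * (u i).2 x).
exists (v, g); split => /=.
- apply: bounded_form_scale; apply: bounded_formB => //.
  by apply: bounded_form_sum => i; exact: ub.
- rewrite /g big1 ?subr0 ?hv ?mulVf ?normr_eq0// => i _.
  by rewrite uv ?mulr0.
- exact: uv.
- move=> j nj; rewrite /g (bigD1 (Ordinal nj))//= uo// eqxx mulr1.
  rewrite big1 ?addr0 ?subrr ?mulr0// => i ij.
  by rewrite uo// -[j]/(nat_of_ord (Ordinal nj)) (inj_eq val_inj) (negbTE ij) mulr0.
Qed.

Lemma biorthogonal_sequence {R : realType} {X : normedModType R} :
  infinite_dimensional X ->
  exists u : nat -> X * (X -> R), forall n, biorthogonal n u.
Proof.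
move=> infX; pose d : X * (X -> R) := (0, fun=> 0).
(* The hypothesis sits inside the existential, so choice yields an extension function on all lists,
   to be iterated from the empty one. *)
have next (s : seq (X * (X -> R))) : exists p : X * (X -> R),
    biorthogonal (size s) (nth d s) -> biorthogonal (size s).+1 (nth d (rcons s p)).
  have [bs|nbs] := pselect (biorthogonal (size s) (nth d s)); last first.
    by exists d => /nbs.
  have [p [pb pp up pu]] := biorthogonal_extend _ _ infX bs.
  have [sb so] := bs.
  exists p => _; split=> [i|i j].
    rewrite ltnS leq_eqVlt => /predU1P[->|si]; rewrite nth_rcons ?ltnn ?eqxx//.
    by rewrite si; exact: sb.
  rewrite ltnS leq_eqVlt => /predU1P[->|si];
    rewrite ltnS leq_eqVlt => /predU1P[->|sj]; rewrite !nth_rcons ?ltnn ?eqxx//.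
  - by rewrite sj pu// gtn_eqF.
  - by rewrite si up// ltn_eqF.
  - by rewrite si sj so.
have [f fP] := choice next.
pose S := fix S n := if n is m.+1 then rcons (S m) (f (S m)) else [::].
pose u n := f (S n); have SE n : S n = mkseq u n.
  by elim: n => // n IHn; rewrite mkseqS -IHn.
exists u => n; suff : biorthogonal n (nth d (S n)).
  rewrite SE => -[ub uo]; split=> [i ni|i j ni nj].
    by have := ub i ni; rewrite nth_mkseq.
  by have := uo i j ni nj; rewrite !nth_mkseq.
elim: n => [|n IHn]; first by split.
by have := fP (S n); rewrite /= SE size_mkseq -SE; exact.
Qed.

(* Stretching [e i] shrinks its coordinate functional, so the norms of the
   latter can be prescribed. *)
Lemma small_biorthogonal_sequence {R : realType} {X : normedModType R}
    (eps : nat -> R) : infinite_dimensional X -> (forall i, 0 < eps i) ->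
  exists (e : nat -> X) (g : nat -> X -> R), [/\ forall i, linear_form (g i),
    forall i x, `|g i x| <= eps i * `|x| & forall i j, g i (e j) = (i == j)%:R].
Proof.
move=> /biorthogonal_sequence[u uP] eps0.
have ub i : bounded_form (u i).2 by exact: (uP i.+1).1.
have uo i j : (u i).2 (u j).1 = (i == j)%:R.
  by apply: (uP (maxn i j).+1).2; rewrite ltnS ?leq_maxl ?leq_maxr.
have [C uC] := choice (fun i => (ub i).2).
(* Adding 1 keeps the factor positive even if [C i] is 0. *)
pose k i := (`|C i| + 1) / eps i.
have k0 i : 0 < k i by rewrite divr_gt0// ltr_wpDl.
exists (fun i => k i *: (u i).1), (fun i x => (k i)^-1 * (u i).2 x); split.
- by move=> i; have [] := bounded_form_scale _ (k i)^-1 (ub i).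
- move=> i x; rewrite normrM gtr0_norm ?invr_gt0// ler_pdivrMl//.
  rewrite mulrA divfK ?gt_eqF//; apply: (le_trans (uC i x)).
  by rewrite ler_wpM2r// (le_trans (ler_norm _))// lerDl.
- move=> i j; rewrite (ub i).1.2 uo; case: eqVneq => [->|_].
    by rewrite mulr1 mulVf ?gt_eqF.
  by rewrite !mulr0.
Qed.

(** * Entropy and its approximate convexity *)

(* The value at [0] is [0], as it should be, since the factor [t] vanishes. *)
Definition eta {R : realType} (t : R) : R := - (t * ln t).

Lemma eta_ge0 {R : realType} (t : R) : 0 <= t <= 1 -> 0 <= eta t.
Proof. by move=> /andP[t0 t1]; rewrite /eta oppr_ge0 mulr_ge0_le0// ln_le0. Qed.

(** The inequality [ln (1 + x) <= x] at [x = t^-1 - 1], multiplied by [t]. *)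
Lemma eta_le_oneB {R : realType} (t : R) : 0 <= t -> eta t <= 1 - t.
Proof.
rewrite le_eqVlt => /predU1P[<-|t0]; first by rewrite /eta mul0r oppr0 addr0.
have := @le_ln1Dx R (t^-1 - 1); rewrite addrCA subrr addr0 lnV// => tV.
rewrite /eta -mulrN -ler_pdivlMl// mulrBr mulr1 mulVf ?gt_eqF//.
by apply: tV; rewrite ltrBrDl subrr invr_gt0.
Qed.

Lemma etaM {R : realType} (a b : R) : 0 <= a -> 0 <= b ->
  eta (a * b) = a * eta b + b * eta a.
Proof.
rewrite /eta le_eqVlt => /predU1P[<-|a0]; first by rewrite !mul0r oppr0 mulr0 addr0.
rewrite le_eqVlt => /predU1P[<-|b0]; first by rewrite !(mul0r,mulr0,oppr0) addr0.
by rewrite lnM//; ring.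
Qed.

Lemma etaD_le {R : realType} (a b : R) : 0 <= a -> 0 <= b ->
  eta (a + b) <= eta a + eta b.
Proof.
rewrite le_eqVlt => /predU1P[<-|a0].
  by move=> _; rewrite add0r lerDr /eta mul0r oppr0.
rewrite le_eqVlt => /predU1P[<-|b0].
  by rewrite addr0 lerDl /eta mul0r oppr0.
rewrite /eta -opprD lerN2 mulrDl lerD// ler_wpM2l ?(ltW a0) ?(ltW b0)//.
  by rewrite ler_ln ?posrE ?addr_gt0// lerDl ltW.
by rewrite ler_ln ?posrE ?addr_gt0// lerDr ltW.
Qed.

(** The error is linear in [a] and [b], so that summed over two probability vectors it leaves only
    [eta t + eta (1 - t)]. *)
Lemma eta_conv {R : realType} (t a b : R) : 0 <= t <= 1 -> 0 <= a -> 0 <= b ->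
  eta (t * a + (1 - t) * b) <=
    t * eta a + (1 - t) * eta b + (a * eta t + b * eta (1 - t)).
Proof.
move=> /andP[t0 t1] a0 b0; have t'0 : 0 <= 1 - t by rewrite subr_ge0.
apply: (le_trans (etaD_le _ _ _ _)); rewrite ?mulr_ge0// !etaM//.
by rewrite addrACA.
Qed.

(** Weights live on all of [nat] with zero tail, so that vectors of different lengths can be
    combined without casts. *)
Definition prob_weights {R : realType} (n : nat) (y : nat -> R) :=
  [/\ forall i, 0 <= y i, forall i, (n <= i)%N -> y i = 0 &
    \sum_(i < n) y i = 1].

Definition entropy {R : realType} (n : nat) (y : nat -> R) : R :=
  \sum_(i < n) eta (y i).

Lemma big_ord_support {V : nmodType} (F : nat -> V) m n : (m <= n)%N ->
  (forall i, (m <= i)%N -> F i = 0) -> \sum_(i < n) F i = \sum_(i < m) F i.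
Proof.
move=> mn F0; rewrite -!(big_mkord xpredT F) (big_cat_nat (leq0n m) mn)/=.
by rewrite [X in _ + X]big_nat_cond [X in _ + X]big1 ?addr0// => i /andP[/andP[/F0]].
Qed.

Lemma prob_weights_widen {R : realType} m n (y : nat -> R) :
  (m <= n)%N -> prob_weights m y -> prob_weights n y.
Proof.
move=> mn [y0 ym y1]; split=> // [i /(leq_trans mn)/ym//|].
by rewrite (big_ord_support _ _ _ mn).
Qed.

Lemma entropy_widen {R : realType} m n (y : nat -> R) :
  (m <= n)%N -> prob_weights m y -> entropy n y = entropy m y.
Proof.
move=> mn [y0 ym y1]; apply: (big_ord_support (eta \o y) _ _ mn) => i /ym /= ->.
by rewrite /eta mul0r oppr0.
Qed.

Lemma prob_weights_conv {R : realType} n t (y z : nat -> R) : 0 <= t <= 1 ->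
  prob_weights n y -> prob_weights n z ->
  prob_weights n (fun i => t * y i + (1 - t) * z i).
Proof.
move=> /andP[t0 t1] [y0 yn y1] [z0 zn z1]; split=> [i|i ni|].
- by rewrite addr_ge0 ?mulr_ge0 ?subr_ge0.
- by rewrite yn// zn// !mulr0 addr0.
- by rewrite big_split/= -!mulr_sumr y1 z1 !mulr1 addrC subrK.
Qed.

(** After summation the error is [eta t + eta (1 - t)], at most [(1 - t) + t = 1]. *)
Lemma entropy_conv {R : realType} n t (y z : nat -> R) : 0 <= t <= 1 ->
  prob_weights n y -> prob_weights n z ->
  entropy n (fun i => t * y i + (1 - t) * z i) <=
    t * entropy n y + (1 - t) * entropy n z + 1.
Proof.
move=> t01 [y0 yn y1] [z0 zn z1]; have /andP[t0 t1] := t01.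
apply: (@le_trans _ _ (\sum_(i < n) (t * eta (y i) + (1 - t) * eta (z i) +
    (y i * eta t + z i * eta (1 - t))))).
  by apply: ler_sum => i _; exact: eta_conv.
rewrite !big_split/= -!mulr_sumr -!mulr_suml y1 z1 !mul1r lerD2l.
have := @eta_le_oneB R t t0; have := @eta_le_oneB R (1 - t); rewrite subr_ge0; lra.
Qed.

(* If each of the [N] weights of a block is within a factor 2 of [1/N], the
   block carries mass at least [1/2] and each weight has [- ln] at least
   [ln (N/2)]. *)
Lemma entropy_block_ge {R : realType} n N (y : nat -> R) :
  prob_weights n y ->
  (forall i, (N <= i < N + N)%N -> (2 * N%:R)^-1 <= y i <= 2 / N%:R) ->
  (1 < N)%N -> ln (N%:R / 2) / 2 <= entropy n y.
Proof.
move=> yn yN N1; have N0 : 0 < N%:R :> R by rewrite ltr0n ltnW.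
have y'n := prob_weights_widen n (maxn n (N + N)) y (leq_maxl _ _) yn.
rewrite -(entropy_widen n _ y (leq_maxl _ (N + N)%N) yn) /entropy.
set m := maxn n _; have [y0 _ y1] := y'n.
have yle1 (i : 'I_m) : y i <= 1.
  by rewrite -y1 (bigD1 i)//= lerDl sumr_ge0.
rewrite -(big_mkord xpredT (eta \o y)).
have Nm : (N + N <= m)%N by exact: leq_maxr.
rewrite (big_cat_nat (leq0n N) (leq_trans (leq_addr N N) Nm))/=.
rewrite (big_cat_nat (leq_addr N N) Nm)/=.
have eta0 a b : (b <= m)%N -> 0 <= \sum_(a <= i < b) eta (y i).
  move=> bm; rewrite big_nat_cond; apply: sumr_ge0 => i /andP[/andP[_ ib] _].
  by apply: eta_ge0; rewrite y0 (yle1 (Ordinal (leq_trans ib bm))).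
apply: (@le_trans _ _ (\sum_(N <= i < N + N) (2 * N%:R)^-1 * ln (N%:R / 2))).
  rewrite sumr_const_nat addnK -[leRHS]mulr_natl; set l := ln _.
  suff -> : N%:R * ((2 * N%:R)^-1 * l) = l / 2 by [].
  by field; rewrite gt_eqF.
apply: (@le_trans _ _ (\sum_(N <= i < N + N) eta (y i))).
  apply: ler_sum_nat => i /yN/andP[yi1 yi2].
  have yi0 : 0 < y i by apply: lt_le_trans yi1; rewrite invr_gt0 mulr_gt0.
  (* From [y i <= 2 / N] comes [- ln (y i) >= ln (N / 2)], which is nonnegative as [N] is at least
     2. *)
  rewrite /eta -mulrN -lnV//; apply: ler_pM => //.
  - by rewrite ln_ge0// ler_pdivlMr// mul1r ler_nat.
  - rewrite ler_ln ?posrE ?invr_gt0 ?divr_gt0//.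
    by rewrite -[N%:R / 2]invrK lef_pV2 ?posrE ?invr_gt0 ?divr_gt0// invf_div.
have := eta0 0 N (leq_trans (leq_addr N N) Nm); have := eta0 (N + N)%N m (leqnn _).
lra.
Qed.

(** * The entropy epigraph and its distance from the block centers *)

Definition entropy_epigraph {R : realType} {X : normedModType R}
    (e : nat -> X) (w : X) : set X :=
  [set x | exists n y s, [/\ prob_weights n y, entropy n y <= s &
    x = \sum_(i < n) y i *: e i + s *: w]].

(** Raising the convex combination by 1 along [w] pays for the error in the entropy and moves the
    point by [|w|]. *)
Lemma approx_convex_entropy_epigraph {R : realType} {X : normedModType R}
    (e : nat -> X) (w : X) : `|w| <= 1 -> approx_convex (entropy_epigraph e w).
Proof.
move=> w1 _ _ [n [y [s [yn ys ->]]]] [m [z [r [zm zr ->]]]] t t01.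
have widen k p (v : nat -> R) : (k <= p)%N -> prob_weights k v ->
    \sum_(i < k) v i *: e i = \sum_(i < p) v i *: e i.
  move=> kp [_ vk _]; rewrite (big_ord_support (fun i => v i *: e i) _ _ kp)//.
  by move=> i /vk ->; rewrite scale0r.
pose p := maxn n m; have [np mp] := (leq_maxl n m, leq_maxr n m).
rewrite -(entropy_widen n p y np yn) in ys.
rewrite -(entropy_widen m p z mp zm) in zr.
rewrite (widen _ _ _ np yn) (widen _ _ _ mp zm).
have yp := prob_weights_widen _ _ _ np yn.
have zp := prob_weights_widen _ _ _ mp zm.
pose v i := t * y i + (1 - t) * z i.
pose h := t * s + (1 - t) * r.
have /andP[t0 t1] := t01.
rewrite /dist_set; apply: (@le_trans _ _ (`|w|)%:E); last by rewrite lee_fin.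
apply: ereal_inf_lbound; exists (\sum_(i < p) v i *: e i + (h + 1) *: w).
  exists p, v, (h + 1); split=> //; first exact: prob_weights_conv.
  apply: (le_trans (entropy_conv _ _ _ _ t01 yp zp)).
  by rewrite lerD2r lerD// ler_wpM2l// subr_ge0.
congr EFin; rewrite -[RHS]normrN; congr `|_|.
have -> : \sum_(i < p) v i *: e i =
    t *: (\sum_(i < p) y i *: e i) + (1 - t) *: (\sum_(i < p) z i *: e i).
  rewrite !scaler_sumr -big_split/=; apply: eq_bigr => i _.
  by rewrite !scalerA -scalerDl.
rewrite !scalerDr addrACA !scalerA -scalerDl -/h opprD addrACA subrr add0r.
by rewrite -scalerBl opprD addrA subrr add0r scaleN1r.
Qed.

Definition block_weights {R : realType} (N : nat) (i : nat) : R :=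
  if (N <= i < N + N)%N then N%:R^-1 else 0.

Definition block_center {R : realType} {X : normedModType R}
    (e : nat -> X) (N : nat) : X :=
  \sum_(i < N + N) block_weights N i *: e i.

Lemma conv_hull_block_center {R : realType} {X : normedModType R}
    (e : nat -> X) (w : X) N : (0 < N)%N ->
  conv_hull (entropy_epigraph e w) (block_center e N).
Proof.
move=> N0; exists (N + N)%N, (fun i => e i), (fun i => block_weights N i); split=> //.
(* Each vertex lies in the epigraph at height 0, as a point mass has zero entropy. *)
- move=> i; exists (N + N)%N, (fun j => (j == i :> nat)%:R), 0.
  have sumi (F : nat -> X) : \sum_(j < N + N) (j == i)%:R *: F j = F i.
    rewrite (bigD1 i)//= eqxx scale1r big1 ?addr0// => j /negbTE.
    by rewrite -(inj_eq val_inj) => /= ->; rewrite scale0r.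
  split; last by rewrite sumi scale0r addr0.
    split=> [j|j Nj|]; first exact: ler0n.
      by rewrite gtn_eqF// (leq_trans (ltn_ord i)).
    rewrite (bigD1 i)//= eqxx big1 ?addr0// => j /negbTE.
    by rewrite -(inj_eq val_inj) => /= ->.
  rewrite /entropy big1// => j _; rewrite /eta.
  by case: eqP; rewrite ?ln1 ?mulr0 ?mul0r oppr0.
- by move=> i; rewrite /block_weights; case: ifP.
- rewrite -(big_mkord xpredT (block_weights N)).
  rewrite (big_cat_nat (leq0n N) (leq_addr N N))/= big_nat_cond big1 ?add0r.
    rewrite (eq_big_nat _ _ (F2 := fun=> N%:R^-1)).
      by rewrite sumr_const_nat addnK -[LHS]mulr_natl mulfV// pnatr_eq0 -lt0n.
    by move=> i Ni; rewrite /block_weights Ni.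
  move=> i /andP[/andP[_ iN] _]; rewrite /block_weights.
  by rewrite leqNgt iN.
Qed.

(** A point of the epigraph closer than [M] has height at most [K * M], by [f], while the [g i]
    force its weights on the block to be near [1 / N]; its entropy would then exceed its height. *)
Lemma dist_block_center_ge {R : realType} {X : normedModType R}
    (e : nat -> X) (g : nat -> X -> R) (w : X) (f : X -> R) (K M : R) N :
  (forall i, linear_form (g i)) ->
  (forall i x, `|g i x| <= i.+1%:R^-2 * `|x|) ->
  (forall i j, g i (e j) = (i == j)%:R) -> (forall i, g i w = 0) ->
  linear_form f -> (forall x, `|f x| <= K * `|x|) -> 0 <= K ->
  (forall i, f (e i) = 0) -> f w = 1 ->
  0 <= M -> (1 < N)%N -> 2 * M <= N%:R -> K * M < ln (N%:R / 2) / 2 ->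
  (M%:E <= dist_set (block_center e N) (entropy_epigraph e w))%E.
Proof.
move=> gl gb ge gw fl fb K0 fe fw M0 N1 MN KM.
apply: le_ereal_inf_tmp => _ [_ [n [y [s [yn ys ->]]]] <-]; rewrite lee_fin.
rewrite leNgt; apply/negP; set z := _ - _ => zM.
have N0 : 0 < N%:R :> R by rewrite ltr0n ltnW.
have [_ yn0 _] := yn.
have sM : `|f z| <= K * M by apply: (le_trans (fb z)); rewrite ler_wpM2l// ltW.
have fz : f z = - s.
  rewrite /z linear_formB// /block_center linear_form_sum// fl.1 fl.2 fw.
  rewrite linear_form_sum// !big1 ?sub0r ?add0r ?mulr1// => i _;
    by rewrite fe mulr0.
have coord m (c : nat -> R) i : (forall i, (m <= i)%N -> c i = 0) ->
    g i (\sum_(j < m) c j *: e j) = c i.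
  move=> cm; rewrite linear_form_sum//; have [im|mi] := ltnP i m.
    rewrite (bigD1 (Ordinal im))//= ge eqxx mulr1 big1 ?addr0// => j ji.
    by rewrite ge eq_sym -[i]/(val (Ordinal im)) (inj_eq val_inj) (negbTE ji) mulr0.
  rewrite cm// big1// => j _.
  by rewrite ge gtn_eqF ?mulr0// (leq_trans (ltn_ord j)).
have gz i : g i z = block_weights N i - y i.
  rewrite /z linear_formB// (gl i).1 (gl i).2 gw mulr0 addr0 !coord// => j Nj.
  by rewrite /block_weights ltnNge Nj andbF.
have yN i : (N <= i < N + N)%N -> (2 * N%:R)^-1 <= y i <= 2 / N%:R.
  move=> Ni; have : `|g i z| <= N%:R^-1 / 2.
    apply: (le_trans (gb i z)).
    (* On the block [i.+1] is larger than [N]; with [2 * M <= N] the bound becomes [N^-1 / 2]. *)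
    apply: (@le_trans _ _ (N%:R^-2 * M)).
      apply: ler_pM => //; last exact: ltW.
      rewrite lef_pV2 ?posrE ?exprn_gt0//.
      by rewrite lerXn2r ?nnegrE ?ler0n// ler_nat; case/andP: Ni => /leqW.
    rewrite ler_pdivrMl ?exprn_gt0// expr2 -mulrA mulVKf ?gt_eqF//.
    lra.
  rewrite gz /block_weights Ni ler_norml invfM => /andP[].
  have : 0 < N%:R^-1 :> R by rewrite invr_gt0.
  move: (N%:R^-1) => a; lra.
have := entropy_block_ge n N y yn yN N1.
move: sM; rewrite fz normrN; have := ler_norm s; lra.
Qed.

Theorem theorem3p3 (R : realType) (X : normedModType R) :
  infinite_dimensional X ->
  exists A : set X, approx_convex A /\ hausdorff A (conv_hull A) = +oo%E.
Proof.
move=> infX.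
(* Index 0 is kept for the direction [w]; after the shift by [succn] the other functionals have
   decay [i.+1%:R^-2]. *)
pose eps (i : nat) : R := if i is j.+1 then j.+1%:R^-2 else 1.
have [|e [g [gl gb ge]]] := small_biorthogonal_sequence eps infX.
  by case=> [|i] //=; rewrite invr_gt0 exprn_gt0.
have e0 : 0 < `|e 0%N|.
  rewrite normr_gt0; apply/eqP => e00; have := ge 0%N 0%N.
  by rewrite e00 -(scale0r 0) (gl 0%N).2 mul0r eqxx => /esym/eqP; rewrite oner_eq0.
pose w := `|e 0%N|^-1 *: e 0%N; pose A := entropy_epigraph (e \o succn) w.
exists A; split.
  apply: approx_convex_entropy_epigraph.
  by rewrite normrZ gtr0_norm ?invr_gt0// mulVf ?gt_eqF.
(* As [w] is [e 0] divided by its norm [K], the form [K * g 0] takes the value 1 at [w]. *)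
apply/eqyP => M M0; pose K := `|e 0%N|.
(* The first summand secures [2 * M <= N], the second [ln (N / 2) > 2 * (K * M)], and [.+2] secures
   [1 < N]. *)
pose N := (Num.bound (2 * M + 2 * expR (2 * (K * M)))).+2.
have NM : 2 * M + 2 * expR (2 * (K * M)) < N%:R.
  apply: lt_le_trans (archi_boundP _) _; last by rewrite ler_nat ltnW.
  by rewrite addr_ge0// mulr_ge0// ?ltW// expR_gt0.
have E0 := expR_gt0 (2 * (K * M)).
have N0 : 0 < N%:R / 2 :> R by rewrite divr_gt0.
apply: (le_trans _ (ereal_sup_ubound _)); last first.
  right; exists (block_center (e \o succn) N) => //.
  exact: conv_hull_block_center.
apply: (@dist_block_center_ge _ _ _ (g \o succn) _ (fun x => K * g 0%N x) K) => //=.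
- by move=> i j; rewrite ge eqSS.
- by move=> i; rewrite (gl _).2 ge mulr0.
- by split=> *; rewrite ?(gl _).1 ?(gl _).2 ?mulrDr// mulrCA.
- move=> x; rewrite normrM (gtr0_norm e0) ler_wpM2l ?(ltW e0)//.
  by have := gb 0%N x; rewrite mul1r.
- exact: ltW.
- by move=> i; rewrite ge mulr0.
- by rewrite (gl _).2 ge mulr1 mulfV ?gt_eqF.
- exact: ltW.
- lra.
- rewrite ltr_pdivlMr// mulrC -[ltLHS]expRK ltr_ln ?posrE//.
  by rewrite ltr_pdivlMr//; lra.
Qed.
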